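(* Let a formal differential parametrization $$w(z,t)=\sum_{k=0}^{\infty}\alpha_{2k}(z)\,y^{(2k)}(t),\qquad u(t)=\sum_{k=0}^{\infty}\beta_{2k}\,y^{(2k)}(t)$$ of the Euler-Bernoulli beam be given, and for each $k\in\mathbb{N}$ let $c_{k,0}$ denote the coefficient of $z^2$ in the polynomial $\alpha_{2k}(z)$. Then the functions $\alpha_{2k}(z)$ and the coefficients $\beta_{2k}$, $k\in\mathbb{N}$, are uniquely determined by the sequence $(c_{k,0})_{k\in\mathbb{N}}$.
   Context: $\mathbb{N}$ includes $0$; $'$ denotes differentiation with respect to $z$; $y^{(m)}$ is the $m$-th time derivative of $y$. The Euler-Bernoulli beam is the system $\partial_t^2 w(z,t)=-\partial_z^4 w(z,t)$, $0\le z\le 1$, $t\ge 0$, with boundary conditions $w(0,t)=0$, $\partial_z w(0,t)=0$, $\partial_z^2 w(1,t)=u(t)$, $\partial_z^3 w(1,t)=0$, where $u(t)$ is the input. A formal differential parametrization (with time derivatives of even order only) consists of functions $\alpha_{2k}:[0,1]\to\mathbb{R}$ and real numbers $\beta_{2k}$, $k\in\mathbb{N}$, such that the series $w(z,t)=\sum_{k\ge 0}\alpha_{2k}(z)y^{(2k)}(t)$ and $u(t)=\sum_{k\ge 0}\beta_{2k}y^{(2k)}(t)$ formally (after interchanging differentiation and summation, without regard to convergence) satisfy the PDE and the boundary conditions for arbitrary smooth functions $y(t)$. This means that the factors of all time derivatives of $y$ vanish, i.e. $$\alpha_0''''(z)=0,\qquad \alpha_{2k}''''(z)=-\alpha_{2(k-1)}(z)\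 \ (k\ge 1),$$ $$\alpha_{2k}(0)=0,\quad \alpha_{2k}'(0)=0,\quad \alpha_{2k}''(1)=\beta_{2k},\quad \alpha_{2k}'''(1)=0\ \ (k\ge 0).$$ The functions $\alpha_{2k}$ are then polynomials of the form $\alpha_{2k}(z)=\sum_{i=0}^{k}\left(c_{k,i}z^{4i+2}+d_{k,i}z^{4i+3}\right)$ with real coefficients $c_{k,i},d_{k,i}$ and $d_{k,k}=0$. *)

(* Defs.v *)
From HB Require Import structures.
From mathcomp Require Import all_boot all_order all_algebra.
From mathcomp Require Import all_classical all_reals all_analysis.
Set Implicit Arguments.
Unset Strict Implicit.
Unset Printing Implicit Defensive.
Import Order.TTheory GRing.Theory Num.Theory.
Import numFieldNormedType.Exports.
Local Open Scope classical_set_scope.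
Local Open Scope ring_scope.

(* A function on the interval [0, 1] is represented by a total function
   R -> R of which only the values on [0, 1] matter: difference quotients only
   use points of [0, 1], so the derivatives at 0 and 1 are one-sided. *)
Definition quot01 (R : realType) (f : R -> R) (z y : R) : R :=
  (f y - f z) / (y - z).

Definition derivable01 (R : realType) (f : R -> R) : Prop :=
  forall z : R, z \in `[0, 1] ->
    cvg (quot01 f z y @[y --> within `[0, 1] z^']).

Definition derive01 (R : realType) (f : R -> R) (z : R) : R :=
  lim (quot01 f z y @[y --> within `[0, 1] z^']).

Definition nderive01 (R : realType) (n : nat) (f : R -> R) : R -> R :=
  iter n (@derive01 R) f.

(* [alpha k] and [beta k] stand for alpha_{2k} and beta_{2k}. The equations say
   that, after formal substitution of w = \sum_k alpha_{2k} y^(2k) and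
   u = \sum_k beta_{2k} y^(2k) into
     w_tt = - w_zzzz,  w(0,t) = w_z(0,t) = 0,  w_zz(1,t) = u(t),  w_zzz(1,t) = 0,
   the factor of each time derivative y^(2k) vanishes. *)
Record formal_diff_param (R : realType)
    (alpha : nat -> R -> R) (beta : nat -> R) : Prop := FormalDiffParam {
  fdp_derivable : forall k n : nat, (n < 4)%N ->
    derivable01 (nderive01 n (alpha k));
  fdp_pde0 : forall z : R, z \in `[0, 1] -> nderive01 4 (alpha 0%N) z = 0;
  fdp_pdeS : forall (k : nat) (z : R), z \in `[0, 1] ->
    nderive01 4 (alpha k.+1) z = - alpha k z;
  fdp_bc0 : forall k : nat, alpha k 0 = 0;
  fdp_bc1 : forall k : nat, nderive01 1 (alpha k) 0 = 0;
  fdp_bc2 : forall k : nat, nderive01 2 (alpha k) 1 = beta k;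
  fdp_bc3 : forall k : nat, nderive01 3 (alpha k) 1 = 0
}.

(* The polynomial that coincides with f on [0, 1] is unique if it exists; the
   default value 0 is used when f is not polynomial on [0, 1], which never
   happens for the functions of a formal differential parametrization. *)
Definition poly01 (R : realType) (f : R -> R) : {poly R} :=
  xget 0 [set p : {poly R} | forall z : R, z \in `[0, 1] -> f z = p.[z]].

(* Main.v *)
(** Since the fourth derivative of alpha_{2k} is 0 or - alpha_{2(k-1)},
    alpha_{2k} is polynomial on [0, 1] by induction on k. If two
    parametrizations agree at k - 1, then their alpha_{2k} differ by a cubic;
    the conditions at 0 kill its coefficients of degree 0 and 1, equality of
    the c_{k,0} the one of degree 2, and alpha_{2k}'''(1) = 0 the one of
    degree 3. *)

Require Import Defs.
From HB Require Import structures.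
From mathcomp Require Import all_boot all_order all_algebra.
From mathcomp Require Import all_classical all_reals all_analysis.
Set Implicit Arguments.
Unset Strict Implicit.
Unset Printing Implicit Defensive.
Import Order.TTheory GRing.Theory Num.Theory.
Import numFieldNormedType.Exports.
Local Open Scope classical_set_scope.
Local Open Scope ring_scope.

(** Unfolds the restricted punctured filter into plain neighbourhoods of [z], where the constraints
    on [y] can be added or discharged one at a time. *)
Lemma cvg_quot01P (R : realType) (f : R -> R) (z l : R) :
  quot01 f z y @[y --> within `[0, 1] z^'] --> l <->
  forall e, 0 < e ->
    \forall y \near z, y != z -> y \in `[0, 1] -> `|l - quot01 f z y| < e.
Proof.
have FF : Filter (within `[0, 1] z^') by exact: within_filter.
split=> [/(@cvgrPdist_lt _ _ _ _ FF) h e /h //|h].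
by apply/cvgrPdist_lt => e /h.
Qed.

(** For [y != z], [f y = quot01 f z y * (y - z) + f z], and the right side tends to
    [l z * 0 + f z]. *)
Lemma quot01_within_continuous (R : realType) (f : R -> R) (l : R -> R) :
  (forall z, z \in `[0, 1] -> quot01 f z y @[y --> within `[0, 1] z^'] --> l z) ->
  {within `[0, 1], continuous f}.
Proof.
move=> hf; apply/subspace_continuousP => z z01.
have {}hf := hf z z01.
have FF : Filter (within `[0, 1] z^') by exact: within_filter.
have h0 : y - z @[y --> within `[0, 1] z^'] --> (0 : R).
  rewrite -[X in _ --> X](subrr z); apply: cvgB; last exact: cvg_cst.
  by apply: cvg_within_filter; exact/cvg_within.
have : quot01 f z y * (y - z) + f z @[y --> within `[0, 1] z^'] --> f z.
  rewrite -[X in _ --> X]add0r -[X in _ --> X + _](mulr0 (l z)).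
  by apply: cvgD; [exact: cvgM | exact: cvg_cst].
move=> /(@cvgrPdist_lt _ _ _ _ FF) h; apply/cvgrPdist_lt => e e0.
have {}h : \forall y \near z, y != z -> y \in `[0, 1] ->
  `|f z - (quot01 f z y * (y - z) + f z)| < e := h e e0.
change (\forall y \near z, y \in `[0, 1] -> `|f z - f y| < e).
apply: filterS h => y h y01.
have [->|yz] := eqVneq y z; first by rewrite subrr normr0.
by have := h yz y01; rewrite /quot01 divfK ?subr_eq0// subrK.
Qed.

(** Near an interior point the restriction to the unit interval is vacuous, so the limit is the
    ordinary derivative after the substitution [y = h + z]. *)
Lemma is_derive_quot01 (R : realType) (f : R -> R) (z l : R) :
  z \in `]0, 1[ -> quot01 f z y @[y --> within `[0, 1] z^'] --> l ->
  is_derive z 1 f l.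
Proof.
move=> z01 hf.
suff h : h^-1 *: ((f \o shift z) (h *: 1) - f z) @[h --> 0^'] --> l.
  by apply: DeriveDef; [apply/cvg_ex; exists l | apply/cvg_lim].
have nz : \forall y \near z, y \in `[0, 1].
  apply: filterS (near_in_itvoo z01) => y; exact: subset_itv_oo_cc.
apply/cvgrPdist_lt => e e0.
have h2 : \forall y \near z, y != z -> `|l - quot01 f z y| < e.
  have h1 := iffLR (cvg_quot01P f z l) hf e e0.
  by apply: filterS2 h1 nz => y h y01 yz; exact: h.
have hs : (h + z) @[h --> (0 : R)] --> z.
  by rewrite -[X in _ --> X]add0r; apply: cvgD; [exact: cvg_id | exact: cvg_cst].
have h3 : \forall h \near (0 : R), h + z != z -> `|l - quot01 f z (h + z)| < e.
  exact: hs _ h2.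
change (\forall h \near (0 : R), h != 0 ->
  `|l - h^-1 *: ((f \o shift z) (h *: 1) - f z)| < e).
apply: filterS h3 => h h3 h0.
have : h + z != z by rewrite -subr_eq0 addrK.
by move/h3; rewrite /quot01 addrK /= [h *: 1]mulr1 mulrC.
Qed.

(** Mean value theorem on [[0, z]]: ordinary derivatives are needed only in the interior, and the
    one-sided limits at the ends supply continuity there. *)
Lemma quot01_eq0_cst (R : realType) (f : R -> R) :
  (forall z, z \in `[0, 1] ->
    quot01 f z y @[y --> within `[0, 1] z^'] --> (0 : R)) ->
  forall z, z \in `[0, 1] -> f z = f 0.
Proof.
move=> hf z; rewrite in_itv /= => /andP[z0 z1].
have sub : `[0, z] `<=` `[0, 1].
  by move=> y /=; rewrite !in_itv /= => /andP[-> /le_trans]; apply.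
have [|| c _] := @MVT_segment R f (fun=> 0) 0 z z0.
- move=> x; rewrite in_itv /= => /andP[x0 xz].
  have x1 := lt_le_trans xz z1.
  apply: is_derive_quot01; first by rewrite in_itv /= x0.
  by apply: hf; rewrite in_itv /= !ltW.
- exact: continuous_subspaceW sub (quot01_within_continuous hf).
- by rewrite mul0r => /eqP; rewrite subr_eq0 => /eqP.
Qed.

Lemma quot01_horner (R : realType) (p : {poly R}) (z : R) :
  quot01 (horner p) z y @[y --> within `[0, 1] z^'] --> p^`().[z].
Proof.
have : root (p - p.[z]%:P) z by rewrite rootE !hornerE subrr.
case/factor_theorem => q pE.
have hq y : p.[y] - p.[z] = q.[y] * (y - z).
  by have := congr1 (horner^~ y) pE; rewrite /= !hornerE.
have -> : p^`().[z] = q.[z].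
  have := congr1 (fun r => (deriv r).[z]) pE.
  by rewrite /= !poly.derivE !hornerE subrr mulr0 add0r subr0.
apply/cvg_quot01P => e e0.
have := iffLR (@cvgrPdist_lt _ _ _ _ (nbhs_filter z) _ _) (@continuous_horner R q z) e e0.
by apply: filterS => y h yz _; rewrite /quot01 hq mulfK // subr_eq0.
Qed.

(* The constant term is [p`_0 / 0 = 0]. *)
Definition primitive (R : realType) (p : {poly R}) : {poly R} :=
  \poly_(i < (size p).+1) (p`_i.-1 / i%:R).

Lemma deriv_primitive (R : realType) (p : {poly R}) : (primitive p)^`() = p.
Proof.
apply/polyP => i; rewrite coef_deriv coef_poly ltnS.
case: ltnP => hi; last by rewrite mul0rn nth_default.
by rewrite -[LHS]mulr_natr /= divfK // pnatr_eq0.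
Qed.

Lemma derive01_horner_inv (R : realType) (f : R -> R) (p : {poly R}) :
  derivable01 f -> (forall z, z \in `[0, 1] -> derive01 f z = p.[z]) ->
  exists2 q : {poly R}, q^`() = p & forall z, z \in `[0, 1] -> f z = q.[z].
Proof.
move=> df fE; pose P := primitive p.
have h z : z \in `[0, 1] -> quot01 (f \- horner P) z y
    @[y --> within `[0, 1] z^'] --> (0 : R).
  move=> z01; have := df z z01.
  rewrite -/(derive01 f z) fE // => h1.
  have -> : quot01 (f \- horner P) z = quot01 f z \- quot01 (horner P) z.
    apply/funext => y.
    by rewrite /quot01 /= -mulrBl !opprB [P.[z] - _]addrC addrACA [- _ + P.[z]]addrC.
  rewrite -[X in _ --> X](subrr p.[z]); apply: cvgB => //.
  by have := @quot01_horner R P z; rewrite deriv_primitive.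
(* The difference [f \- horner P] has zero derivative, so it keeps its value at 0, which is the
   constant of integration. *)
exists (P + (f 0 - P.[0])%:P); first by rewrite derivD derivC addr0 deriv_primitive.
move=> z z01; rewrite hornerD hornerC; have /= <- := quot01_eq0_cst h z01.
by rewrite addrC subrK.
Qed.

(** Integrates [n] times, from the highest derivative down. All intermediate orders are recorded
    because the boundary conditions involve them. *)
Lemma nderive01_horner_inv (R : realType) (f : R -> R) (n : nat) (p : {poly R}) :
  (forall m, (m < n)%N -> derivable01 (nderive01 m f)) ->
  (forall z, z \in `[0, 1] -> nderive01 n f z = p.[z]) ->
  exists2 q : {poly R}, q^`(n) = p & forall m z, (m <= n)%N -> z \in `[0, 1] ->
    nderive01 m f z = q^`(m).[z].
Proof.
elim: n p => [|n IH] p df fE.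
  by exists p => // -[|m] z // _; exact: fE.
have [p1 p1E hp1] := derive01_horner_inv (df n (ltnSn n)) fE.
have [m mn|q qE hq] := IH p1 _ hp1; first exact/df/ltnW.
have qS : q^`(n.+1) = p by rewrite derivnS qE.
exists q => // m z; rewrite leq_eqVlt => /predU1P[->|mn] z01; last exact: hq.
by rewrite fE // qS.
Qed.

Lemma horner_inj01 (R : realType) (p q : {poly R}) :
  (forall z, z \in `[0, 1] -> p.[z] = q.[z]) -> p = q.
Proof.
move=> pq; apply/eqP; rewrite -subr_eq0; apply/negPn/negP => nz.
set n := size (p - q).
(* A nonzero polynomial of size [n] has fewer than [n] roots, but the [n] distinct points 1/(i+1), i
   < n, all lie in the unit interval. *)
have := @max_poly_roots _ _ [seq i.+1%:R^-1 | i <- iota 0 n] nz.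
rewrite size_map size_iota ltnn => h; suff: false by []; apply: h.
- apply/allP => _ /mapP[i _ ->]; rewrite rootE !hornerE pq ?subrr // in_itv /=.
  by rewrite invr_ge0 ler0n invf_le1 ?ltr0n// ler1n.
- by rewrite map_inj_uniq ?iota_uniq // => i j /invr_inj/eqP; rewrite eqr_nat => /eqP[].
Qed.

Lemma poly01_horner (R : realType) (f : R -> R) (p : {poly R}) :
  (forall z, z \in `[0, 1] -> f z = p.[z]) -> poly01 f = p.
Proof.
move=> fp; apply: horner_inj01 => z z01.
have /= h : [set q : {poly R} | forall z, z \in `[0, 1] -> f z = q.[z]] (poly01 f).
  by apply: xgetPex; exists p.
by rewrite -fp // -h.
Qed.

(** Order 0 of the conclusion at [k] makes the fourth derivative at [k.+1] the polynomial [- p],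
    which is then integrated four times. *)
Lemma formal_diff_param_poly (R : realType) (alpha : nat -> R -> R)
    (beta : nat -> R) (h : formal_diff_param alpha beta) (k : nat) :
  exists p : {poly R}, forall m z, (m <= 4)%N -> z \in `[0, 1] ->
    nderive01 m (alpha k) z = p^`(m).[z].
Proof.
elim: k => [|k [p hp]].
  have [z z01|q _ hq] := nderive01_horner_inv (p := 0) (@fdp_derivable _ _ _ h 0%N).
    by rewrite (fdp_pde0 h z01) horner0.
  by exists q.
have [z z01|q _ hq] := nderive01_horner_inv (p := - p) (@fdp_derivable _ _ _ h k.+1).
  by rewrite (fdp_pdeS h _ z01) hornerN -(hp 0).
by exists q.
Qed.

Lemma cubic_bc_eq0 (R : realType) (d : {poly R}) :
  d^`(4) = 0 -> d.[0] = 0 -> d^`().[0] = 0 -> d`_2 = 0 -> d^`(3).[1] = 0 -> d = 0.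
Proof.
move=> d4 d0 d1 d2 d3.
have dge i : (4 <= i)%N -> d`_i = 0.
  move=> /subnK <-; have := congr1 (fun p : {poly R} => p`_(i - 4)) d4.
  rewrite coef_derivn coef0 addnC => /eqP.
  by rewrite mulrn_eq0 => /orP[|/eqP //]; rewrite eqn0Ngt ffact_gt0 leq_addl.
have d00 : d`_0 = 0 by rewrite -horner_coef0.
have d01 : d`_1 = 0 by rewrite -[RHS]d1 horner_coef0 coef_deriv.
have d03 : d`_3 = 0.
  (* The factor 6 is 3!; all higher coefficients vanish by [dge]. *)
  have E : d^`(3) = (d`_3 *+ 6)%:P.
    apply/polyP => i; rewrite coef_derivn coefC.
    by case: i => [|i] //=; rewrite dge ?mul0rn.
  by move: d3; rewrite E hornerC => /eqP; rewrite mulrn_eq0 => /eqP.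
by apply/polyP => -[|[|[|[|i]]]]; rewrite coef0 // dge.
Qed.

Theorem theorem3 (R : realType)
    (alpha alpha' : nat -> R -> R) (beta beta' : nat -> R)
    (hparam : formal_diff_param alpha beta)
    (hparam' : formal_diff_param alpha' beta')
    (hc : forall k : nat, (poly01 (alpha k))`_2 = (poly01 (alpha' k))`_2) :
  (forall (k : nat) (z : R), z \in `[0, 1] -> alpha k z = alpha' k z) /\
  (forall k : nat, beta k = beta' k).
Proof.
have i0 : (0 : R) \in `[0, 1] by rewrite in_itv /= lexx ler01.
have i1 : (1 : R) \in `[0, 1] by rewrite in_itv /= lexx ler01.
have [p hp] := choice (formal_diff_param_poly hparam).
have [q hq] := choice (formal_diff_param_poly hparam').
(* Applies [cubic_bc_eq0] to [p k - q k]. Only the agreement of the fourth derivatives depends on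
   the stage of the induction. *)
have step k : (forall z, z \in `[0, 1] ->
    nderive01 4 (alpha k) z = nderive01 4 (alpha' k) z) -> p k = q k.
  move=> d4; apply/eqP; rewrite -subr_eq0; apply/eqP/cubic_bc_eq0.
  - rewrite derivnB; apply/eqP; rewrite subr_eq0; apply/eqP/horner_inj01 => z z01.
    by rewrite -(hp k 4%N z isT z01) -(hq k 4%N z isT z01) d4.
  - rewrite hornerD hornerN -(hp k 0%N 0 isT i0) -(hq k 0%N 0 isT i0) /=.
    by rewrite (fdp_bc0 hparam) (fdp_bc0 hparam') subrr.
  - rewrite derivB hornerD hornerN -(hp k 1%N 0 isT i0) -(hq k 1%N 0 isT i0).
    by rewrite (fdp_bc1 hparam) (fdp_bc1 hparam') subrr.
  (* The chosen [p k] and [q k] are the polynomials [poly01] of [hc], by uniqueness on the unit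
     interval. *)
  - rewrite coefB -(@poly01_horner _ (alpha k) (p k) (fun z => hp k 0%N z isT)).
    by rewrite -(@poly01_horner _ (alpha' k) (q k) (fun z => hq k 0%N z isT)) hc subrr.
  - rewrite derivnB hornerD hornerN -(hp k 3%N 1 isT i1) -(hq k 3%N 1 isT i1).
    by rewrite (fdp_bc3 hparam) (fdp_bc3 hparam') subrr.
have pq k : p k = q k.
  elim: k => [|k IH]; apply: step => z z01.
    by rewrite (fdp_pde0 hparam) // (fdp_pde0 hparam').
  rewrite (fdp_pdeS hparam) // (fdp_pdeS hparam') //.
  by rewrite -[alpha k z]/(nderive01 0 (alpha k) z) (hp k 0%N z isT z01) IH -(hq k 0%N z isT z01).
split=> [k z z01|k]; last first.
  (* Each [beta k] is the second derivative of [alpha k] at 1, hence is read off from [p k]. *)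
  rewrite -(fdp_bc2 hparam) -(fdp_bc2 hparam').
  by rewrite (hp k 2%N 1 isT i1) (hq k 2%N 1 isT i1) pq.
by have := hp k 0%N z isT z01; rewrite pq -(hq k 0%N z isT z01).
Qed.
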